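(* Hall's universal countable locally finite group $U$ is isomorphic to a subgroup of $\mathrm{Comm}(\mathbb{F})$, the abstract commensurator of a finite-rank nonabelian free group; that is, there is an injective group homomorphism $U \to \mathrm{Comm}(\mathbb{F})$.
   Context: A group is locally finite if every finitely generated subgroup is finite. Hall's universal group $U$ is the countable locally finite group, unique up to isomorphism, such that (i) every finite group $C$ embeds in $U$, and (ii) for every finite group $C$, any two embeddings of $C$ into $U$ are conjugate by an element of $U$ (in particular, any two isomorphic finite subgroups of $U$ are conjugate in $U$). It may be constructed as follows: fix any finite group $G_0$ with at least 3 elements, recursively let $G_{k+1}$ be the group of all permutations of the underlying set of $G_k$, let $\ell_k : G_k \to G_{k+1}$ be the injective homomorphism given by left multiplication, and let $U$ be the colimit of the sequence $(G_k,\ell_k)$. For a group $G$, the abstract commensurator $\mathrm{Comm}(G)$ is the set of isomorphisms $\phi : H \to K$ between finite-index subgroups $H, K \leq G$, modulo the equivalence relation identifying two such isomorphisms when they agree on some finite-index subgroup of $G$ contained in both domains; it is a group under composition (defined after restricting to a suitable finite-index subgroup). Let $\mathbb{F}_k$ be the free group of rank $k$. For all finite $k \geq 2$ the groups $\mathbb{F}_k$ and $\mathbb{F}_2$ have isomorphic finite-index subgroups, so $\mathrm{Comm}(\mathbb{F}_k) \cong \mathrm{Comm}(\mathbb{F}_2)$, and this group is denoted $\mathrm{Comm}(\mathbb{F})$. *)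

(* Defs.v *)
(* Groups, possibly infinite, are MathComp's [groupType]s; subgroups are      *)
(* classical sets.                                                            *)
From HB Require Import structures.
From mathcomp Require Import all_boot all_fingroup.
From mathcomp Require Import boolp classical_sets functions cardinality.

Set Implicit Arguments.
Unset Strict Implicit.
Unset Printing Implicit Defensive.

Local Open Scope classical_set_scope.
Local Open Scope group_scope.

Section Subgroups.
Variable G : groupType.
Implicit Types (A H K : set G) (x y : G).

Definition is_subgroup H : Prop :=
  [/\ H 1, forall x y, H x -> H y -> H (x * y) & forall x, H x -> H x^-1].

Definition subgroup_generated A : set G := smallest is_subgroup A.

Definition left_coset H x : set G := [set x * h | h in H].

Definition finite_index H : Prop := finite_set (range (left_coset H)).

Definition fi_subgroup H : Prop := is_subgroup H /\ finite_index H.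

End Subgroups.

Section HallUniversal.
Variable U : groupType.

Definition locally_finite : Prop :=
  forall A : set U, finite_set A -> finite_set (subgroup_generated A).

(* [x ^ u] is the conjugate [u^-1 * x * u]. *)
Definition hall_universal : Prop :=
  [/\ countable [set: U],
      locally_finite,
      forall C : finGroupType,
        exists f : {multiplicative C -> U}, injective f
    & forall (C : finGroupType) (f g : {multiplicative C -> U}),
        injective f -> injective g ->
        exists u : U, forall c : C, g c = f c ^ u].

End HallUniversal.

Section FreeGroup.
Variable T : choiceType.

(* The letter [(t, false)] stands for the generator [t], and [(t, true)] for  *)
(* its inverse.                                                               *)
Local Notation letter := (T * bool)%type.

Implicit Types (a b : letter) (u v w : seq letter).

Definition letter_inv a : letter := (a.1, ~~ a.2).

Definition reduced w : bool := sorted (fun a b => b != letter_inv a) w.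

Definition push a w : seq letter :=
  if w is b :: w' then if b == letter_inv a then w' else a :: w else [:: a].

(* For reduced [v], the reduced form of the concatenation [u ++ v]. *)
Definition word_mul u v : seq letter := foldr push v u.

Definition word_inv w : seq letter := rev (map letter_inv w).

Lemma letter_invK : involutive letter_inv.
Proof. by case=> t b; rewrite /letter_inv /= negbK. Qed.

Lemma reduced_behead a w : reduced (a :: w) -> reduced w.
Proof. exact: path_sorted. Qed.

Lemma reduced_push a w : reduced w -> reduced (push a w).
Proof.
case: w => [//|b w]; rewrite /push; case: ifPn => [_ /reduced_behead //|ba rw].
by rewrite /reduced /= ba.
Qed.

Lemma reduced_mul u v : reduced v -> reduced (word_mul u v).
Proof. by move=> rv; elim: u => //= a u; apply: reduced_push. Qed.

Lemma push_cons a w : reduced (a :: w) -> push a w = a :: w.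
Proof. by case: w => // b w /andP[/negbTE]; rewrite /push => ->. Qed.

Lemma pushK a w : reduced w -> push a (push (letter_inv a) w) = w.
Proof.
case: w => [_|b w rw] /=; first by rewrite eqxx.
rewrite letter_invK; case: eqP => [<-|_]; first by apply: push_cons.
by rewrite /= eqxx.
Qed.

Lemma word_mul_push a u v :
  reduced v -> word_mul (push a u) v = push a (word_mul u v).
Proof.
case: u => [//|b u] rv /=; case: eqP => [->|//].
by rewrite pushK ?reduced_mul.
Qed.

Lemma word_mulA u v w :
  reduced w -> word_mul u (word_mul v w) = word_mul (word_mul u v) w.
Proof. by move=> rw; elim: u => //= a u ->; rewrite word_mul_push. Qed.

Lemma word_mul1 u : reduced u -> word_mul u [::] = u.
Proof.
elim: u => //= a u IHu rau; rewrite IHu ?push_cons //.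
exact: reduced_behead rau.
Qed.

Lemma word_invK : involutive word_inv.
Proof. by move=> w; rewrite /word_inv map_rev revK (mapK letter_invK). Qed.

Lemma reduced_inv w : reduced w -> reduced (word_inv w).
Proof.
rewrite /reduced /word_inv rev_sorted sorted_map; apply: sub_sorted => a b.
by apply: contra => /eqP/(can_inj letter_invK) ->; rewrite letter_invK.
Qed.

Lemma word_mulVw w : reduced w -> word_mul (word_inv w) w = [::].
Proof.
elim: w => // a w IHw raw.
rewrite /word_inv /word_mul /= rev_cons foldr_rcons /= letter_invK eqxx.
exact: IHw (reduced_behead raw).
Qed.

Record free_group := FreeGroup {
  word_of : seq letter;
  _ : reduced word_of
}.

HB.instance Definition _ := [isSub for word_of].
HB.instance Definition _ := [Choice of free_group by <:].

Lemma reduced_word_of (x : free_group) : reduced (word_of x).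
Proof. exact: valP x. Qed.

Definition free_one : free_group := @FreeGroup [::] isT.

Definition free_mul (x y : free_group) : free_group :=
  FreeGroup (reduced_mul (word_of x) (reduced_word_of y)).

Definition free_inv (x : free_group) : free_group :=
  FreeGroup (reduced_inv (reduced_word_of x)).

Lemma free_mulA : associative free_mul.
Proof.
by move=> x y z; apply: val_inj; rewrite /= word_mulA ?reduced_word_of.
Qed.

Lemma free_mul1g : left_id free_one free_mul.
Proof. by move=> x; apply: val_inj. Qed.

Lemma free_mulg1 : right_id free_one free_mul.
Proof. by move=> x; apply: val_inj; rewrite /= word_mul1 ?reduced_word_of. Qed.

Lemma free_mulVg : left_inverse free_one free_inv free_mul.
Proof. by move=> x; apply: val_inj; rewrite /= word_mulVw ?reduced_word_of. Qed.

Lemma free_mulgV : right_inverse free_one free_inv free_mul.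
Proof.
move=> x; apply: val_inj; rewrite /= -{1}[word_of x]word_invK.
by rewrite word_mulVw ?reduced_inv ?reduced_word_of.
Qed.

HB.instance Definition _ :=
  isGroup.Build free_group free_mulA free_mul1g free_mulg1 free_mulVg free_mulgV.

Definition free_gen (t : T) : free_group := @FreeGroup [:: (t, false)] isT.

Lemma free_group_ind (P : free_group -> Prop) :
  P 1 -> (forall t x, P x -> P (free_gen t * x)) ->
  (forall t x, P x -> P ((free_gen t)^-1 * x)) -> forall x, P x.
Proof.
move=> P1 Pg Pv [w]; elim: w => [|a w IHw] rw.
  by have -> : FreeGroup rw = 1 by apply: val_inj.
have := IHw (reduced_behead rw); case: a rw => t [] rw Pw.
- have -> : FreeGroup rw = (free_gen t)^-1 * FreeGroup (reduced_behead rw).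
    by apply: val_inj; rewrite /= -(push_cons rw).
  exact: Pv.
- have -> : FreeGroup rw = free_gen t * FreeGroup (reduced_behead rw).
    by apply: val_inj; rewrite /= -(push_cons rw).
  exact: Pg.
Qed.

Section Universal.
Variables (H : groupType) (y : T -> H).

Let eval_letter (a : letter) : H := if a.2 then (y a.1)^-1 else y a.1.
Let eval_word (w : seq letter) : H := foldr (fun a h => eval_letter a * h) 1 w.

Definition free_lift (x : free_group) : H := eval_word (word_of x).

Lemma free_liftM : {morph free_lift : x z / x * z}.
Proof.
have evalV a : eval_letter a * eval_letter (letter_inv a) = 1.
  by case: a => t [] /=; rewrite /eval_letter /= ?mulVg ?mulgV.
have evalP a w : eval_word (push a w) = eval_letter a * eval_word w.
  by case: w => //= b w; case: eqP => // ->; rewrite /= mulgA evalV mul1g.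
move=> [u ru] [v rv]; rewrite /free_lift /=.
by elim: u ru => [|a u IHu] ru /=; rewrite ?mul1g // evalP IHu ?mulgA //;
   exact: reduced_behead ru.
Qed.

HB.instance Definition _ :=
  isMultiplicative.Build free_group H free_lift free_liftM.

Lemma free_group_universal :
  exists2 f : {multiplicative free_group -> H},
    forall t, f (free_gen t) = y t &
    forall g : {multiplicative free_group -> H},
      (forall t, g (free_gen t) = y t) -> g =1 f.
Proof.
have gen_lift t : free_lift (free_gen t) = y t.
  by rewrite /free_lift /= /eval_letter mulg1.
exists free_lift => // g gP.
have g1 : g 1 = 1 by apply: (mulgI (g 1)); rewrite -gmulfM !mulg1.
have gV x : g x^-1 = (g x)^-1.
  by apply: (mulgI (g x)); rewrite -gmulfM !mulgV g1.
have liftV t : free_lift (free_gen t)^-1 = (y t)^-1.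
  by rewrite /free_lift /= /eval_letter mulg1.
apply: free_group_ind => [|t x IHx|t x IHx].
- by rewrite g1.
- by rewrite gmulfM IHx gP [RHS]gmulfM /= gen_lift.
- by rewrite gmulfM gV IHx gP [RHS]gmulfM /= liftV.
Qed.

End Universal.
End FreeGroup.

Section SubgroupTheory.
Variable G : groupType.
Implicit Types (A D H K : set G) (x y : G).

Lemma is_subgroupT : is_subgroup [set: G]. Proof. by []. Qed.

Lemma is_subgroupI H K :
  is_subgroup H -> is_subgroup K -> is_subgroup (H `&` K).
Proof.
move=> [H1 HM HV] [K1 KM KV]; split=> // [x y [Hx Kx] [Hy Ky]|x [Hx Kx]].
  by split; [exact: HM|exact: KM].
by split; [exact: HV|exact: KV].
Qed.

Lemma finite_indexP H : is_subgroup H -> finite_index H <->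
  exists s : seq G, forall x, exists2 t, t \in s & H (t^-1 * x).
Proof.
move=> [H1 HM HV]; split=> [|[s sP]].
  move=> fH; have /finite_seqP[s sE] := finite_image (xget 1) fH; exists s => x.
  exists (xget 1 (left_coset H x)).
    have : (xget 1 @` range (left_coset H)) (xget 1 (left_coset H x)).
      by exists (left_coset H x) => //; exists x.
    by rewrite sE.
  have : left_coset H x x by exists 1; rewrite ?mulg1.
  move=> /(xgetI 1) [h Hh <-]; rewrite invgM mulgKV; exact: HV.
apply: (@sub_finite_set _ _ (left_coset H @` [set` s])).
  move=> _ [x _ <-]; have [t ts Htx] := sP x; exists t => //.
  apply/seteqP; split=> _ [h Hh <-].
    exists ((t^-1 * x)^-1 * h); first by apply: HM => //; apply: HV.
    by rewrite invgM invgK !mulgA mulgV mul1g.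
  by exists (t^-1 * x * h); [exact: HM|rewrite !mulgA mulgV mul1g].
exact: finite_image (finite_seq _).
Qed.

Lemma finite_index_reps A D : is_subgroup A -> finite_index A ->
  is_subgroup D -> exists2 s : seq G, forall t, t \in s -> D t &
    forall x, D x -> exists2 t, t \in s & A (t^-1 * x).
Proof.
move=> sA /(finite_indexP sA)[s sP] [D1 _ _]; case: sA => [A1 AM AV].
pose P t := [set d | D d /\ A (t^-1 * d)].
exists [seq xget 1 (P t) | t <- s] => [_ /mapP[t _ ->]|x Dx].
  by case: xgetP => // d _ [].
have [t ts Atx] := sP x; exists (xget 1 (P t)); first exact: map_f.
have /(xgetI 1) [_ Atd] : P t x by [].
have -> : (xget 1 (P t))^-1 * x = (t^-1 * xget 1 (P t))^-1 * (t^-1 * x).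
  by rewrite invgM invgK mulgA mulgK.
by apply: AM => //; apply: AV.
Qed.

Lemma fi_subgroupT : fi_subgroup [set: G].
Proof.
split; first exact: is_subgroupT.
by apply/(finite_indexP is_subgroupT); exists [:: 1] => x; exists 1; rewrite ?inE.
Qed.

Lemma fi_subgroupI H K :
  fi_subgroup H -> fi_subgroup K -> fi_subgroup (H `&` K).
Proof.
move=> [sH fH] [sK fK]; have sHK := is_subgroupI sH sK.
split=> //; apply/(finite_indexP sHK).
have [s sP] := (finite_indexP sH).1 fH.
have [r rD rP] := finite_index_reps sK fK sH.
exists [seq t * u | t <- s, u <- r] => x.
have [t ts Hx] := sP x; have [u ur Ku] := rP _ Hx.
exists (t * u); first exact: allpairs_f.
rewrite invgM -mulgA; split=> //.
case: sH => _ HM HV; apply: HM => //; exact: HV (rD _ ur).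
Qed.

End SubgroupTheory.

Section Commensurator.
Variable G : groupType.
Implicit Types (H K L : set G) (x y : G).

(* An isomorphism [fi_dom -> fi_cod] between finite-index subgroups; the      *)
(* values of [fi_fun] outside [fi_dom] are irrelevant.                        *)
Record fi_iso := FiIso {
  fi_dom : set G;
  fi_cod : set G;
  fi_fun : G -> G;
  fi_domP : fi_subgroup fi_dom;
  fi_codP : fi_subgroup fi_cod;
  fi_bij : set_bij fi_dom fi_cod fi_fun;
  fi_morph : forall x y, fi_dom x -> fi_dom y ->
    fi_fun (x * y) = fi_fun x * fi_fun y
}.

HB.instance Definition _ := gen_eqMixin fi_iso.
HB.instance Definition _ := gen_choiceMixin fi_iso.

Implicit Types f g h : fi_iso.

Definition fi_agree f g : Prop :=
  exists L : set G, [/\ fi_subgroup L, L `<=` fi_dom f, L `<=` fi_dom g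
                      & forall x, L x -> fi_fun f x = fi_fun g x].

Lemma fi_cod_fun f x : fi_dom f x -> fi_cod f (fi_fun f x).
Proof. by have [fC _ _] := fi_bij f; apply: fC. Qed.

Lemma fi_fun_inj f x y :
  fi_dom f x -> fi_dom f y -> fi_fun f x = fi_fun f y -> x = y.
Proof. by have [_ fI _] := fi_bij f; move=> ? ?; apply: fI; rewrite inE. Qed.

Lemma fi_fun1 f : fi_fun f 1 = 1.
Proof.
have [[D1 _ _] _] := fi_domP f.
by apply: (mulgI (fi_fun f 1)); rewrite -fi_morph // !mulg1.
Qed.

Lemma fi_funV f x : fi_dom f x -> fi_fun f x^-1 = (fi_fun f x)^-1.
Proof.
have [[D1 _ DV] _] := fi_domP f => Dx.
by apply: (mulgI (fi_fun f x)); rewrite -fi_morph ?mulgV ?fi_fun1 //; apply: DV.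
Qed.

Lemma fi_image f H : fi_subgroup H -> H `<=` fi_dom f ->
  fi_subgroup (fi_fun f @` H).
Proof.
move=> [sH fH] HD; have [H1 HM HV] := sH.
have sI : is_subgroup (fi_fun f @` H).
  split; first by exists 1; rewrite ?fi_fun1.
    move=> _ _ [x Hx <-] [y Hy <-]; exists (x * y); first exact: HM.
    by rewrite fi_morph //; apply: HD.
  by move=> _ [x Hx <-]; exists x^-1; [exact: HV|rewrite fi_funV //; apply: HD].
have [sD fD] := fi_domP f; have [sC fC] := fi_codP f.
split=> //; apply/(finite_indexP sI).
have [s sP] := (finite_indexP sC).1 fC.
have [r rD rP] := finite_index_reps sH fH sD.
exists [seq t * fi_fun f u | t <- s, u <- r] => x.
have [t ts Cx] := sP x.
have [_ _ /(_ _ Cx)[d Dd fd]] := fi_bij f.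
have [u ur Hu] := rP _ Dd.
exists (t * fi_fun f u); first exact: (allpairs_f (fun t u => t * fi_fun f u)).
exists (u^-1 * d) => //; have Du := rD _ ur; case: sD => _ _ DV.
by rewrite fi_morph ?fi_funV //; [rewrite fd invgM mulgA|exact: DV].
Qed.

Lemma fi_id_bij : set_bij [set: G] [set: G] id.
Proof. by split=> // x _; exists x. Qed.

Definition fi_id : fi_iso :=
  @FiIso setT setT id (fi_subgroupT G) (fi_subgroupT G) fi_id_bij
    (fun _ _ _ _ => erefl).

Section Inverse.
Variable f : fi_iso.

Definition fi_inv_fun : G -> G := 'pinv_(fun=> 1) (fi_dom f) (fi_fun f).

Lemma fi_inv_bij : set_bij (fi_cod f) (fi_dom f) fi_inv_fun.
Proof. exact: bijpinv_bij (fi_bij f). Qed.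

Lemma fi_inv_dom y : fi_cod f y -> fi_dom f (fi_inv_fun y).
Proof. by have [H _ _] := fi_inv_bij; apply: H. Qed.

Lemma fi_invK y : fi_cod f y -> fi_fun f (fi_inv_fun y) = y.
Proof.
have [_ _ fS] := fi_bij f => Cy.
by apply: (surjpK _ fS); rewrite inE.
Qed.

Lemma fi_funK x : fi_dom f x -> fi_inv_fun (fi_fun f x) = x.
Proof.
by move=> Dx; apply: (@fi_fun_inj f) => //;
   [apply: fi_inv_dom|rewrite fi_invK //]; apply: fi_cod_fun.
Qed.

Lemma fi_inv_morph x y : fi_cod f x -> fi_cod f y ->
  fi_inv_fun (x * y) = fi_inv_fun x * fi_inv_fun y.
Proof.
have [[_ DM _] _] := fi_domP f; have [[_ CM _] _] := fi_codP f => Cx Cy.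
have Dx := fi_inv_dom Cx; have Dy := fi_inv_dom Cy.
apply: (@fi_fun_inj f); [exact/fi_inv_dom/CM|exact: DM|].
by rewrite fi_morph // !fi_invK //; apply: CM.
Qed.

Definition fi_inv : fi_iso :=
  FiIso (fi_codP f) (fi_domP f) fi_inv_bij fi_inv_morph.

End Inverse.

Lemma fi_preimage f H : fi_subgroup H ->
  fi_subgroup [set x | fi_dom f x /\ H (fi_fun f x)].
Proof.
move=> fiH.
have -> : [set x | fi_dom f x /\ H (fi_fun f x)] =
          fi_fun (fi_inv f) @` (fi_cod f `&` H).
  apply/seteqP; split=> [x [Dx Hx]|_ [y [Cy Hy] <-]] /=.
    exists (fi_fun f x); last exact: fi_funK.
    by split=> //; apply: fi_cod_fun.
  by rewrite fi_invK //; split=> //; apply: fi_inv_dom.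
apply: fi_image => [|x []//].
exact: fi_subgroupI (fi_codP f) fiH.
Qed.

(* The composite [f o g] ([g] is applied first), defined on the largest       *)
(* possible domain.                                                           *)
Section Composition.
Variables f g : fi_iso.

Definition fi_comp_dom : set G := [set x | fi_dom g x /\ fi_dom f (fi_fun g x)].

Definition fi_comp_fun : G -> G := fi_fun f \o fi_fun g.

Lemma fi_comp_domP : fi_subgroup fi_comp_dom.
Proof. exact/fi_preimage/fi_domP. Qed.

Lemma fi_comp_codP : fi_subgroup (fi_comp_fun @` fi_comp_dom).
Proof.
rewrite -image_comp; apply: fi_image => [|_ [x [_ Dfx] <-] //].
by apply: fi_image => [|x []//]; apply: fi_comp_domP.
Qed.

Lemma fi_comp_bij :
  set_bij fi_comp_dom (fi_comp_fun @` fi_comp_dom) fi_comp_fun.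
Proof.
apply: inj_bij => x y; rewrite !inE => -[Dx Dgx] [Dy Dgy] /fi_fun_inj fxy.
by apply: (@fi_fun_inj g) => //; apply: fxy.
Qed.

Lemma fi_comp_morph x y : fi_comp_dom x -> fi_comp_dom y ->
  fi_comp_fun (x * y) = fi_comp_fun x * fi_comp_fun y.
Proof. by move=> [? ?] [? ?]; rewrite /fi_comp_fun /= !fi_morph. Qed.

Definition fi_comp : fi_iso :=
  FiIso fi_comp_domP fi_comp_codP fi_comp_bij fi_comp_morph.

End Composition.

Lemma fi_agree_refl f : fi_agree f f.
Proof. by exists (fi_dom f); split=> //; apply: fi_domP. Qed.

Lemma fi_agree_sym f g : fi_agree f g -> fi_agree g f.
Proof. by move=> [L [? ? ? fg]]; exists L; split=> // x /fg. Qed.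

Lemma fi_agree_trans g f h : fi_agree f g -> fi_agree g h -> fi_agree f h.
Proof.
move=> [L [fiL Lf Lg fg]] [K [fiK Kg Kh gh]]; exists (L `&` K); split.
- exact: fi_subgroupI.
- by move=> x [/Lf].
- by move=> x [_ /Kh].
- by move=> x [Lx Kx]; rewrite fg ?gh.
Qed.

Lemma fi_agree_comp f f' g g' :
  fi_agree f f' -> fi_agree g g' -> fi_agree (fi_comp f g) (fi_comp f' g').
Proof.
move=> [L [fiL Lf Lf' ff']] [K [fiK Kg Kg' gg']].
exists (K `&` [set x | fi_dom g x /\ L (fi_fun g x)]); split.
- by apply: fi_subgroupI => //; apply: fi_preimage.
- by move=> x [Kx [Dx Lx]]; split=> //; apply: Lf.
- by move=> x [Kx [Dx Lx]]; split; [exact: Kg'|rewrite -gg' //; apply: Lf'].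
- by move=> x [Kx [Dx Lx]]; rewrite /= /fi_comp_fun /= -gg' // ff'.
Qed.

Lemma fi_agree_inv f g : fi_agree f g -> fi_agree (fi_inv f) (fi_inv g).
Proof.
move=> [L [fiL Lf Lg fg]]; exists (fi_fun f @` L); split.
- exact: fi_image.
- by move=> _ [x Lx <-]; apply/fi_cod_fun/Lf.
- by move=> _ [x Lx <-]; rewrite fg //; apply/fi_cod_fun/Lg.
- move=> _ [x Lx <-]; rewrite /= fi_funK; last exact: Lf.
  by rewrite fg // fi_funK //; apply: Lg.
Qed.

Lemma fi_agree_compA f g h :
  fi_agree (fi_comp f (fi_comp g h)) (fi_comp (fi_comp f g) h).
Proof.
exists (fi_dom (fi_comp f (fi_comp g h))); split=> //.
  exact: fi_domP.
by move=> x [[? ?] ?].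
Qed.

Lemma fi_agree_comp1f f : fi_agree (fi_comp fi_id f) f.
Proof.
by exists (fi_dom f); split=> //; apply: fi_domP.
Qed.

Lemma fi_agree_compf1 f : fi_agree (fi_comp f fi_id) f.
Proof.
by exists (fi_dom f); split=> //; apply: fi_domP.
Qed.

Lemma fi_agree_compVf f : fi_agree (fi_comp (fi_inv f) f) fi_id.
Proof.
exists (fi_dom f); split=> //; first exact: fi_domP.
  by move=> x Dx; split=> //; apply: fi_cod_fun.
by move=> x Dx; rewrite /= /fi_comp_fun /= fi_funK.
Qed.

Lemma fi_agree_compfV f : fi_agree (fi_comp f (fi_inv f)) fi_id.
Proof.
exists (fi_cod f); split=> //; first exact: fi_codP.
  by move=> x Cx; split=> //; apply: fi_inv_dom.
by move=> x Cx; rewrite /= /fi_comp_fun /= fi_invK.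
Qed.

Definition fi_agreeb f g : bool := `[< fi_agree f g >].

Lemma fi_agreeb_refl : reflexive fi_agreeb.
Proof. by move=> f; apply/asboolP/fi_agree_refl. Qed.

Lemma fi_agreeb_sym : symmetric fi_agreeb.
Proof. by move=> f g; apply/asboolP/asboolP => /fi_agree_sym. Qed.

Lemma fi_agreeb_trans : transitive fi_agreeb.
Proof.
by move=> g f h /asboolP fg /asboolP gh; apply/asboolP/(fi_agree_trans fg gh).
Qed.

Canonical fi_agree_equiv :=
  EquivRel fi_agreeb fi_agreeb_refl fi_agreeb_sym fi_agreeb_trans.

Definition Comm : Type := {eq_quot fi_agreeb}%qT.
HB.instance Definition _ := Choice.on Comm.
HB.instance Definition _ := EqQuotient.on Comm.

Definition comm_class f : Comm := \pi_Comm%qT f.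

Lemma comm_classP f g : comm_class f = comm_class g <-> fi_agree f g.
Proof.
split=> [/eqP|fg]; last by apply/eqP; rewrite eqmodE; apply/asboolP.
by rewrite eqmodE => /asboolP.
Qed.

(* [repr] alone denotes the operation on subsets of a finite group. *)
Local Notation repr := generic_quotient.repr.

Lemma comm_repr (c : Comm) : comm_class (repr c) = c.
Proof. exact: reprK. Qed.

Lemma repr_comm_class f : fi_agree (repr (comm_class f)) f.
Proof. by apply/comm_classP; rewrite comm_repr. Qed.

Definition comm_one : Comm := comm_class fi_id.

Definition comm_mul (c d : Comm) : Comm := comm_class (fi_comp (repr c) (repr d)).

Definition comm_inv (c : Comm) : Comm := comm_class (fi_inv (repr c)).

Lemma comm_mulE f g :
  comm_mul (comm_class f) (comm_class g) = comm_class (fi_comp f g).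
Proof. by apply/comm_classP/fi_agree_comp; apply: repr_comm_class. Qed.

Lemma comm_invE f : comm_inv (comm_class f) = comm_class (fi_inv f).
Proof. exact/comm_classP/fi_agree_inv/repr_comm_class. Qed.

Lemma comm_mulA : associative comm_mul.
Proof.
move=> c d e; rewrite -(comm_repr c) -(comm_repr d) -(comm_repr e) !comm_mulE.
exact/comm_classP/fi_agree_compA.
Qed.

Lemma comm_mul1g : left_id comm_one comm_mul.
Proof.
move=> c; rewrite -(comm_repr c) comm_mulE.
exact/comm_classP/fi_agree_comp1f.
Qed.

Lemma comm_mulg1 : right_id comm_one comm_mul.
Proof.
move=> c; rewrite -(comm_repr c) comm_mulE.
exact/comm_classP/fi_agree_compf1.
Qed.

Lemma comm_mulVg : left_inverse comm_one comm_inv comm_mul.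
Proof.
move=> c; rewrite -(comm_repr c) comm_invE comm_mulE.
exact/comm_classP/fi_agree_compVf.
Qed.

Lemma comm_mulgV : right_inverse comm_one comm_inv comm_mul.
Proof.
move=> c; rewrite -(comm_repr c) comm_invE comm_mulE.
exact/comm_classP/fi_agree_compfV.
Qed.

HB.instance Definition _ :=
  isGroup.Build Comm comm_mulA comm_mul1g comm_mulg1 comm_mulVg comm_mulgV.

End Commensurator.

(* Main.v *)
Require Import Defs.
From mathcomp Require Import all_boot all_fingroup.
From HB Require Import structures.
From mathcomp Require Import boolp classical_sets functions cardinality.
From mathcomp Require Import zify ring.

(* A finite group H acting freely on a finite set X permutes the basis of the *)
(* free group F(X), hence embeds in Comm(F(X)). Covers of the rose on X with  *)
(* an H-fixed vertex give H-invariant finite-index subgroups F(Z) of F(X),    *)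
(* with Z again a free H-set, and F(Z), F(X) have the same commensurator      *)
(* compatibly with H. Comparing ranks, all free finite H-sets with at least   *)
(* two points are related by such covers, so the embeddings of H obtained in  *)
(* this way in Comm(F_k) are all conjugate. An embedding of H therefore       *)
(* extends to any larger finite group K: restrict to H the embedding given by *)
(* a free K-set, and conjugate it. A countable locally finite group is an     *)
(* increasing union of finite subgroups, so it embeds in Comm(F_k).           *)

Set Implicit Arguments.
Unset Strict Implicit.
Unset Printing Implicit Defensive.

Local Open Scope classical_set_scope.
Local Open Scope group_scope.

(** * Bijections and free groups *)

(** Finite subgroups are embedded one after another, and the point is to make each embedding
    restrict to the previous one. Permuting a basis is faithful in the commensurator
    ([perm_class_eq1]), and a finite-index embedding of free groups that is equivariant for
    permutations of the bases identifies the two commensurators equivariantly ([comm_transport],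
    [comm_equiv_embedding]).

    The covers [star] supply such embeddings. For a group of order [h], a star cover of degree
    [1 + h * m] relates [r] free orbits of generators to [q] of them, where
    [h * q - 1 = (h * r - 1) * (1 + h * m)] by Euler characteristic. These factors suffice to bring
    any two positive values of [h * r - 1] together ([comm_equiv_copies]), so all free actions on at
    least two points are equivalent ([comm_equiv_free]). This gives the extension step
    [freely_realized_extend], and [locally_finite_embedding] takes the union. *)

Section GroupHom.
Variables (G H : groupType) (f : {multiplicative G -> H}).

Lemma hom1 : f 1 = 1.
Proof. by apply: (mulgI (f 1)); rewrite -gmulfM !mulg1. Qed.

Lemma homV : {morph f : x / x^-1}.
Proof. by move=> x; apply: (mulgI (f x)); rewrite -gmulfM !mulgV hom1. Qed.

Lemma homX n : {morph f : x / x ^+ n}.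
Proof.
by move=> x; elim: n => [|n IHn]; rewrite ?hom1 // !expgS gmulfM IHn.
Qed.

End GroupHom.

(** [T] may be infinite, as [sheet] usually is. Products compose right to left, so that left
    multiplication is an action and [perm_class] a homomorphism. *)
Record bijection (T : Type) := Bijection {
  bij_fun :> T -> T;
  bij_inv : T -> T;
  bij_funK : cancel bij_fun bij_inv;
  bij_invK : cancel bij_inv bij_fun
}.

Section BijectionGroup.
Variable T : Type.
Implicit Types s t : bijection T.

HB.instance Definition _ := gen_eqMixin (bijection T).
HB.instance Definition _ := gen_choiceMixin (bijection T).

Lemma bijection_ext s t : s =1 t -> s = t.
Proof.
move=> st.
have inv_st : bij_inv s =1 bij_inv t.
  by move=> x; apply: (can_inj (bij_funK s)); rewrite bij_invK st bij_invK.
case: s t st inv_st => [f f' fK f'K] [g g' gK g'K] /= /funext fg /funext fg'.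
subst g g'.
by rewrite (Prop_irrelevance fK gK) (Prop_irrelevance f'K g'K).
Qed.

Lemma bij_fun_inj s : injective s. Proof. exact: can_inj (bij_funK s). Qed.

Definition bij_one : bijection T :=
  @Bijection T id id (fun _ => erefl) (fun _ => erefl).

Definition bij_opp s : bijection T := Bijection (bij_invK s) (bij_funK s).

Definition bij_mul s t : bijection T :=
  @Bijection T (s \o t) (bij_inv t \o bij_inv s)
    (can_comp (bij_funK s) (bij_funK t)) (can_comp (bij_invK t) (bij_invK s)).

Lemma bij_mulA : associative bij_mul.
Proof. by move=> s t u; apply: bijection_ext. Qed.

Lemma bij_mul1g : left_id bij_one bij_mul.
Proof. by move=> s; apply: bijection_ext. Qed.

Lemma bij_mulg1 : right_id bij_one bij_mul.
Proof. by move=> s; apply: bijection_ext. Qed.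

Lemma bij_mulVg : left_inverse bij_one bij_opp bij_mul.
Proof. by move=> s; apply: bijection_ext => x /=; rewrite bij_funK. Qed.

Lemma bij_mulgV : right_inverse bij_one bij_opp bij_mul.
Proof. by move=> s; apply: bijection_ext => x /=; rewrite bij_invK. Qed.

HB.instance Definition _ := isGroup.Build (bijection T)
  bij_mulA bij_mul1g bij_mulg1 bij_mulVg bij_mulgV.

Lemma bijM s t x : (s * t) x = s (t x). Proof. by []. Qed.

Lemma bijVE s x : s^-1 x = bij_inv s x. Proof. by []. Qed.

End BijectionGroup.

Section FreeMap.

Lemma free_hom_ext (X : choiceType) (G : groupType)
    (f g : {multiplicative free_group X -> G}) :
  (forall x, f (free_gen x) = g (free_gen x)) -> f =1 g.
Proof.
move=> fg; have [h _ hP] := free_group_universal (f \o @free_gen X).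
by move=> x; rewrite (hP f) // (hP g) // => t; rewrite -fg.
Qed.

Definition free_hom (X : choiceType) (G : groupType) (y : X -> G) :
    {multiplicative free_group X -> G} :=
  s2val (cid2 (free_group_universal y)).

Lemma free_hom_gen (X : choiceType) (G : groupType) (y : X -> G) x :
  free_hom y (free_gen x) = y x.
Proof. exact: s2valP (cid2 (free_group_universal y)) x. Qed.

Definition free_map (X Y : choiceType) (s : X -> Y) :
    {multiplicative free_group X -> free_group Y} :=
  free_hom (@free_gen Y \o s).

Lemma free_map_gen (X Y : choiceType) (s : X -> Y) x :
  free_map s (free_gen x) = free_gen (s x).
Proof. exact: free_hom_gen. Qed.

Lemma free_map_id (X : choiceType) : free_map (@id X) =1 id.
Proof.
by apply: (@free_hom_ext _ _ _ idfun) => x; rewrite free_map_gen.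
Qed.

Lemma free_map_comp (X Y Z : choiceType) (s : Y -> Z) (t : X -> Y) :
  free_map (s \o t) =1 free_map s \o free_map t.
Proof.
apply: (@free_hom_ext _ _ _ (free_map s \o free_map t)) => x /=.
by rewrite !free_map_gen.
Qed.

Lemma free_mapK (X Y : choiceType) (s : X -> Y) (t : Y -> X) :
  cancel s t -> cancel (free_map s) (free_map t).
Proof.
move=> sK x; have := free_map_comp t s x; rewrite /= => <-.
by have /funext -> : t \o s =1 id by []; rewrite free_map_id.
Qed.

Lemma word_of_genX (X : choiceType) (x : X) n :
  word_of (free_gen x ^+ n) = nseq n (x, false).
Proof.
elim: n => [|n IHn]; first by rewrite expg0.
rewrite expgS /= IHn; case: n {IHn} => //= n.
by rewrite /letter_inv; case: eqP => // -[].
Qed.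

Lemma free_genX_inj (X : choiceType) (x y : X) n :
  free_gen x ^+ n.+1 = free_gen y ^+ n.+1 -> x = y.
Proof. by move=> /(congr1 (@word_of X)); rewrite !word_of_genX /= => -[]. Qed.

End FreeMap.

(** * Basis permutations as commensurations *)

Section PermClass.

(** Pigeonhole: two of the powers [x ^+ i] with [i <= size s] lie in the same coset. *)
Lemma finite_index_expg (G : groupType) (H : set G) x :
  fi_subgroup H -> exists n, H (x ^+ n.+1).
Proof.
move=> [sH fH]; have [s sP] := (finite_indexP sH).1 fH.
have [H1 HM HV] := sH.
have tP (i : 'I_(size s).+1) :
    exists j : 'I_(size s), H ((nth 1 s j)^-1 * x ^+ i).
  have [t ts Ht] := sP (x ^+ i).
  have tl : index t s < size s by rewrite index_mem.
  by exists (Ordinal tl); rewrite nth_index.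
have [c cP] := choice tP.
have /injectivePn[i [j ij cij]] : ~~ injectiveb c.
  by apply/negP => /injectiveP/leq_card; rewrite !card_ord ltnn.
wlog lt_ij : i j ij cij / i < j.
  move=> wl; have [|lt_ji|eq_ij] := ltngtP i j.
  - exact: wl.
  - by apply: (wl j i) => //; rewrite eq_sym.
  - by move: ij; rewrite (ord_inj eq_ij) eqxx.
exists (j - i).-1; rewrite prednK ?subn_gt0 //.
rewrite -[x ^+ _](mulKg (x ^+ i)) -expgnDr subnKC ?(ltnW lt_ij) //.
have -> : x ^- i * x ^+ j =
    ((nth 1 s (c i))^-1 * x ^+ i)^-1 * ((nth 1 s (c j))^-1 * x ^+ j).
  by rewrite -cij invgM invgK !mulgA mulgK.
by apply: HM => //; apply: HV.
Qed.

Variable X : choiceType.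
Implicit Types s t : bijection X.

Lemma free_map_bij s :
  set_bij [set: free_group X] [set: free_group X] (free_map s).
Proof.
have sK := free_mapK (bij_funK s); have s'K := free_mapK (bij_invK s).
split=> // [x y _ _ /(can_inj sK) //|y _].
by exists (free_map (bij_inv s) y) => //; apply: s'K.
Qed.

Definition perm_iso s : fi_iso (free_group X) :=
  FiIso (fi_subgroupT _) (fi_subgroupT _) (free_map_bij s)
    (fun x y _ _ => gmulfM x y).

Definition perm_class s : Comm (free_group X) := comm_class (perm_iso s).

Lemma perm_classM : {morph perm_class : s t / s * t}.
Proof.
move=> s t; rewrite [RHS]comm_mulE; apply/comm_classP; exists setT.
split=> //; first exact: fi_subgroupT.
by move=> x _; apply: free_map_comp.
Qed.

HB.instance Definition _ := isMultiplicative.Build _ _ perm_class perm_classM.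

(** Some positive power of each generator lies in the subgroup where [free_map s] is the identity,
    and a generator is determined by any positive power. *)
Lemma perm_class_eq1 s : perm_class s = 1 -> s = 1.
Proof.
move=> /comm_classP[L [fiL _ _ sL]]; apply: bijection_ext => x.
have [n /sL /=] := finite_index_expg (free_gen x) fiL.
by rewrite homX free_map_gen => /free_genX_inj.
Qed.

End PermClass.

(** * Transport of commensurators along finite-index embeddings *)

Section FiniteIndexEmbedding.
Variables (G G' : groupType) (j : {multiplicative G -> G'}).
Hypotheses (j_inj : injective j) (j_fi : fi_subgroup (range j)).

Lemma fi_hom_image (H : set G) : fi_subgroup H -> fi_subgroup (j @` H).
Proof.
move=> [sH fH]; have [H1 HM HV] := sH.
have sI : is_subgroup (j @` H).
  split; first by exists 1; rewrite ?hom1.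
    move=> _ _ [x Hx <-] [y Hy <-].
    by exists (x * y); rewrite ?gmulfM //; apply: HM.
  by move=> _ [x Hx <-]; exists x^-1; rewrite ?homV //; apply: HV.
split=> //; apply/(finite_indexP sI).
have [sR fR] := j_fi; have [s sP] := (finite_indexP sR).1 fR.
have [r rP] := (finite_indexP sH).1 fH.
exists [seq t * j u | t <- s, u <- r] => x.
have [t ts [d _ jd]] := sP x; have [u ur Hu] := rP d.
exists (t * j u); first exact: (allpairs_f (fun t u => t * j u)).
by exists (u^-1 * d) => //; rewrite gmulfM homV jd invgM mulgA.
Qed.

Lemma fi_hom_preimage (H : set G') : fi_subgroup H -> fi_subgroup (j @^-1` H).
Proof.
move=> [sH fH]; have [H1 HM HV] := sH.
have sI : is_subgroup (j @^-1` H).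
  split=> [|x y Hx Hy|x Hx]; rewrite /preimage /= ?hom1 ?gmulfM ?homV //.
    exact: HM.
  exact: HV.
split=> //; apply/(finite_indexP sI).
(* The representatives are taken in [range j], so that they can be pulled back to [G]. *)
have [s sR sP] := finite_index_reps sH fH j_fi.1.
exists [seq xget 1 [set x | j x = t] | t <- s] => x.
have [|t ts Ht] := sP (j x); first by exists x.
exists (xget 1 [set x | j x = t]); first exact: map_f.
have [y _ jy] := sR _ ts.
have jt : j (xget 1 [set x | j x = t]) = t.
  by apply: (@xgetPex _ 1 [set x | j x = t]); exists y.
by rewrite /preimage /= gmulfM homV jt.
Qed.

(** The graph, on representatives, of the isomorphism induced by [j]. Asking for equality only on
    some finite-index [L] makes it insensitive to restriction. *)
Definition fi_conjugate (f : fi_iso G) (f' : fi_iso G') : Prop :=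
  exists L, [/\ fi_subgroup L, L `<=` fi_dom f, j @` L `<=` fi_dom f'
              & forall x, L x -> fi_fun f' (j x) = j (fi_fun f x)].

Let jinv (y : G') : G := xget 1 [set x | j x = y].

Let jK x : jinv (j x) = x.
Proof. by apply: xget_unique => // y /j_inj. Qed.

Lemma fi_conjugate_total f : exists f', fi_conjugate f f'.
Proof.
have [D1 DM DV] := (fi_domP f).1.
have bij : set_bij (j @` fi_dom f) (j @` fi_cod f) (j \o fi_fun f \o jinv).
  split=> [_ [x Dx <-]|z w|_ [y Cy <-]].
  - by exists (fi_fun f x); [exact: fi_cod_fun|rewrite /= jK].
  - rewrite !inE => -[x Dx <-] [y Dy <-]; rewrite /= !jK.
    by move=> /j_inj/fi_fun_inj ->.
  - have [_ _ /(_ _ Cy)[x Dx <-]] := fi_bij f.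
    by exists (j x); [exists x|rewrite /= jK].
have mor z w : (j @` fi_dom f) z -> (j @` fi_dom f) w ->
    (j \o fi_fun f \o jinv) (z * w) =
    (j \o fi_fun f \o jinv) z * (j \o fi_fun f \o jinv) w.
  move=> [x Dx <-] [y Dy <-].
  by rewrite -gmulfM /= !jK fi_morph // gmulfM.
exists (FiIso (fi_hom_image (fi_domP f)) (fi_hom_image (fi_codP f)) bij mor).
exists (fi_dom f); split=> // [|x Dx]; first exact: fi_domP.
by rewrite /= jK.
Qed.

(** Restrict [f'] to the elements of [range j] that it sends back into [range j], and pull back
    along [j]. *)
Lemma fi_conjugate_surj f' : exists f, fi_conjugate f f'.
Proof.
have [D1 DM DV] := (fi_domP f').1.
pose D := j @^-1` [set x | fi_dom f' x /\ range j (fi_fun f' x)].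
pose C := j @^-1` (fi_fun f' @` (fi_dom f' `&` range j)).
have fiD : fi_subgroup D by apply/fi_hom_preimage/fi_preimage.
have fiC : fi_subgroup C.
  apply/fi_hom_preimage/fi_image; last by move=> x [].
  exact: fi_subgroupI (fi_domP _) j_fi.
pose g := jinv \o fi_fun f' \o j.
have gP x : D x -> j (g x) = fi_fun f' (j x).
  by move=> [_ [y _ yx]]; rewrite /g /= -yx jK.
have bij : set_bij D C g.
  split=> [x Dx|x y|y [z [Dx [x _ xz]] xy]].
  - rewrite /C /preimage /= gP //; exists (j x) => //; split; last by exists x.
    by case: Dx.
  - rewrite !inE => Dx Dy /(congr1 j); rewrite !gP //.
    by case: Dx Dy => [Dx _] [Dy _] /fi_fun_inj H; apply/j_inj/H.
  - have Dx' : D x by rewrite -xz in Dx xy; split=> //; exists y.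
    by exists x => //; apply: j_inj; rewrite gP // xz.
have mor x y : D x -> D y -> g (x * y) = g x * g y.
  move=> Dx Dy; have [_ DDM _] := fiD.1.
  apply: j_inj; rewrite gP; last exact: DDM.
  by rewrite !gmulfM !gP // fi_morph; case: Dx Dy => [? _] [].
exists (FiIso fiD fiC bij mor); exists D; split=> //.
- by move=> _ [x [? _] <-].
- by move=> x Dx; rewrite /= gP.
Qed.

(** The two directions make the induced map on classes well defined and injective. *)
Lemma fi_conjugate_agree f g f' g' :
  fi_conjugate f f' -> fi_conjugate g g' -> fi_agree f g <-> fi_agree f' g'.
Proof.
move=> [L [fiL Lf Lf' fL]] [K [fiK Kg Kg' gK]]; split=> -[M [fiM Mf Mg fg]].
- exists (j @` (L `&` K `&` M)); split.
  + by apply: fi_hom_image; do !apply: fi_subgroupI.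
  + by move=> _ [x [[? ?] ?] <-]; apply: Lf'; exists x.
  + by move=> _ [x [[? ?] ?] <-]; apply: Kg'; exists x.
  + by move=> _ [x [[? ?] ?] <-]; rewrite fL // gK // fg.
- exists (L `&` K `&` j @^-1` M); split.
  + by apply: fi_subgroupI; [exact: fi_subgroupI|exact: fi_hom_preimage].
  + by move=> x [[/Lf]].
  + by move=> x [[_ /Kg]].
  + by move=> x [[Lx Kx] Mx]; apply: j_inj; rewrite -fL // -gK // fg.
Qed.

Lemma fi_conjugate_comp f g f' g' :
  fi_conjugate f f' -> fi_conjugate g g' ->
  fi_conjugate (fi_comp f g) (fi_comp f' g').
Proof.
move=> [L [fiL Lf Lf' fL]] [K [fiK Kg Kg' gK]].
exists (K `&` [set x | fi_dom g x /\ L (fi_fun g x)]); split.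
- by apply: fi_subgroupI => //; apply: fi_preimage.
- by move=> x [_ [Dx Lx]]; split=> //; apply: Lf.
- move=> _ [x [Kx [Dx Lx]] <-]; split; first by apply: Kg'; exists x.
  by rewrite gK //; apply: Lf'; exists (fi_fun g x).
- by move=> x [Kx [Dx Lx]]; rewrite /= /fi_comp_fun /= gK // fL.
Qed.

Lemma comm_transport : exists tau : {multiplicative Comm G -> Comm G'},
  bijective tau /\
  forall f f', fi_conjugate f f' -> tau (comm_class f) = comm_class f'.
Proof.
have [c cP] := choice fi_conjugate_total.
have [d dP] := choice fi_conjugate_surj.
pose tau (x : Comm G) := comm_class (c (generic_quotient.repr x)).
have tauP f f' : fi_conjugate f f' -> tau (comm_class f) = comm_class f'.
  move=> ff'; apply/comm_classP/(fi_conjugate_agree (cP _) ff').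
  exact: repr_comm_class.
have tauM : {morph tau : x y / x * y}.
  move=> x y; rewrite [RHS]comm_mulE -{1}[x]comm_repr -{1}[y]comm_repr.
  rewrite [_ * _]comm_mulE; apply: tauP.
  by apply: fi_conjugate_comp; apply: cP.
pose tau_hom := HB.pack_for {multiplicative Comm G -> Comm G'} tau
  (isMultiplicative.Build _ _ tau tauM).
exists tau_hom; split=> //.
exists (fun y : Comm G' => comm_class (d (generic_quotient.repr y))) => [x|y].
- rewrite -[RHS]comm_repr; apply/comm_classP.
  apply/(fi_conjugate_agree (dP _) (cP _)).
  exact: repr_comm_class.
- by rewrite /= (tauP _ _ (dP _)) comm_repr.
Qed.

End FiniteIndexEmbedding.

(** * Equivariant isomorphisms of commensurators *)

Section CommEquiv.
Variables (U : groupType) (D : set U).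

Definition acts (X : Type) (a : U -> bijection X) : Prop :=
  forall g h, D g -> D h -> a (g * h) = a g * a h.

Definition acts_freely (X : Type) (a : U -> bijection X) : Prop :=
  acts a /\ forall g x, D g -> a g x = x -> g = 1.

(** Values of [a] and [b] outside [D] are irrelevant, so an action of a larger subgroup restricts to
    [D] without change of type. *)
Definition comm_equiv (X Y : choiceType) (a : U -> bijection X)
    (b : U -> bijection Y) : Prop :=
  exists tau : {multiplicative Comm (free_group X) -> Comm (free_group Y)},
    bijective tau /\ forall g, D g -> tau (perm_class (a g)) = perm_class (b g).

Lemma comm_equiv_sym (X Y : choiceType) (a : U -> bijection X)
    (b : U -> bijection Y) : comm_equiv a b -> comm_equiv b a.
Proof.
move=> [tau [[tau' tauK tau'K] tauP]].
pose tau'_hom := HB.pack_for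
  {multiplicative Comm (free_group Y) -> Comm (free_group X)}
  tau' (isMultiplicative.Build _ _ tau' (can2_gmulfM tauK tau'K)).
exists tau'_hom; split=> [|g Dg]; first by exists tau.
by rewrite -tauP //= tauK.
Qed.

Lemma comm_equiv_trans (X Y Z : choiceType) (a : U -> bijection X)
    (b : U -> bijection Y) (c : U -> bijection Z) :
  comm_equiv a b -> comm_equiv b c -> comm_equiv a c.
Proof.
move=> [tau [tau_bij tauP]] [sigma [sigma_bij sigmaP]].
exists (sigma \o tau); split=> [|g Dg /=]; first exact: bij_comp.
by rewrite tauP // sigmaP.
Qed.

Lemma comm_equiv_embedding (X Z : choiceType) (a : U -> bijection X)
    (c : U -> bijection Z) (j : {multiplicative free_group Z -> free_group X}) :
  injective j -> fi_subgroup (range j) ->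
  (forall g z, D g -> j (free_gen (c g z)) = free_map (a g) (j (free_gen z))) ->
  comm_equiv c a.
Proof.
move=> j_inj j_fi jP; have [tau [tau_bij tauP]] := comm_transport j_inj j_fi.
exists tau; split=> // g Dg; apply: tauP; exists setT.
split=> //; first exact: fi_subgroupT.
move=> x _ /=.
apply: (@free_hom_ext _ _ (free_map (a g) \o j) (j \o free_map (c g))) => z.
by rewrite /= free_map_gen jP.
Qed.

Lemma comm_equiv_bij (X Z : choiceType) (a : U -> bijection X)
    (c : U -> bijection Z) (e : Z -> X) :
  bijective e -> (forall g z, D g -> e (c g z) = a g (e z)) -> comm_equiv c a.
Proof.
move=> [e' eK e'K] eP; apply: (@comm_equiv_embedding _ _ _ _ (free_map e)).
- exact: can_inj (free_mapK eK).
- have -> : range (free_map e) = setT; last exact: fi_subgroupT.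
  apply/seteqP; split=> // x _; exists (free_map e' x) => //.
  exact: free_mapK e'K x.
- by move=> g z Dg; rewrite !free_map_gen eP.
Qed.

End CommEquiv.

(** * The star cover *)

Section StarCover.
Variables X0 X1 : finType.

Local Notation X := (X0 + X1)%type.
Local Notation Z := (X1 + X0 * (X0 + X1))%type.

(* The non-tree edges of the cover of the rose on [X] with vertex set        *)
(* [option X0] in which the loop [inl y] is unwrapped to a 2-cycle between    *)
(* [None] and [Some y]; the spanning tree is the star centred at [None].      *)
Definition star_gen (z : Z) : free_group X :=
  match z with
  | inl x => free_gen (inr x)
  | inr (y, x) =>
      if x == inl y then free_gen (inl y) * free_gen (inl y)
      else (free_gen (inl y))^-1 * (free_gen x * free_gen (inl y))
  end.

Definition star : {multiplicative free_group Z -> free_group X} :=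
  free_hom star_gen.

Lemma starE z : star (free_gen z) = star_gen z.
Proof. exact: free_hom_gen. Qed.

Local Notation sheet := (option X0 * free_group Z)%type.

(** Left multiplication by a generator, in the coordinates of [sheet_val]: a vertex for the coset
    representative, a word in the non-tree edges for the rest. A tree edge contributes no letter. *)
Definition sheet_fun (x : X) (p : sheet) : sheet :=
  match p with
  | (None, w) => match x with
                 | inl y => (Some y, w)
                 | inr x1 => (None, free_gen (inl x1) * w)
                 end
  | (Some y, w) => (if x == inl y then None else Some y,
                    free_gen (inr (y, x)) * w)
  end.

Definition sheet_inv (x : X) (p : sheet) : sheet :=
  match p with
  | (None, w) => match x with
                 | inl y => (Some y, (free_gen (inr (y, inl y)))^-1 * w)
                 | inr x1 => (None, (free_gen (inl x1))^-1 * w)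
                 end
  | (Some y, w) => if x == inl y then (None, w)
                   else (Some y, (free_gen (inr (y, x)))^-1 * w)
  end.

Lemma sheet_funK x : cancel (sheet_fun x) (sheet_inv x).
Proof.
case=> -[y|] w /=; last by case: x => [y|x1]; rewrite /= ?eqxx ?mulKg.
by case: ifP => [/eqP ->|xy]; rewrite ?xy mulKg.
Qed.

Lemma sheet_invK x : cancel (sheet_inv x) (sheet_fun x).
Proof.
case=> -[y|] w /=; last by case: x => [y|x1]; rewrite /= ?eqxx mulVKg.
by case: ifP => [/eqP ->|xy] //=; rewrite xy mulVKg.
Qed.

Definition sheet_bij x := Bijection (sheet_funK x) (sheet_invK x).

Definition sheet_act : {multiplicative free_group X -> bijection sheet} :=
  free_hom sheet_bij.

Lemma sheet_actE x : sheet_act (free_gen x) = sheet_bij x.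
Proof. exact: free_hom_gen. Qed.

Lemma sheet_act_gen x p : sheet_act (free_gen x) p = sheet_fun x p.
Proof. by rewrite sheet_actE. Qed.

Lemma sheet_act_genV x p : sheet_act (free_gen x)^-1 p = sheet_inv x p.
Proof. by rewrite homV sheet_actE. Qed.

Lemma sheet_act_star_gen z w :
  sheet_act (star_gen z) (None, w) = (None, free_gen z * w).
Proof.
case: z => [x|[y x]]; first by rewrite sheet_act_gen.
rewrite /star_gen; case: ifPn => [/eqP ->|/negbTE xy];
  rewrite !gmulfM !bijM ?sheet_act_genV.
  by rewrite !sheet_act_gen /= eqxx.
by rewrite !sheet_act_gen /= xy eqxx.
Qed.

(** Acting on [(None, 1)] therefore recovers [u] from [star u], whence [star_inj]. *)
Lemma sheet_act_star u w : sheet_act (star u) (None, w) = (None, u * w).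
Proof.
elim/free_group_ind: u w => [|z u IHu|z u IHu] w.
- by rewrite hom1 hom1 mul1g.
- by rewrite !gmulfM bijM IHu starE sheet_act_star_gen mulgA.
- rewrite !gmulfM bijM IHu homV starE homV bijVE.
  rewrite -[RHS](bij_funK (sheet_act (star_gen z))).
  by rewrite sheet_act_star_gen -mulgA mulVKg.
Qed.

Lemma star_inj : injective star.
Proof.
move=> u v /(congr1 (fun x => (sheet_act x (None, 1)).2)).
by rewrite !sheet_act_star !mulg1.
Qed.

Definition sheet_val (p : sheet) : free_group X :=
  (if p.1 is Some y then free_gen (inl y) else 1) * star p.2.

(** At [p = (None, 1)] this writes every [x] as a vertex representative times an element of
    [range star], which bounds the index. *)
Lemma sheet_val_act x p : sheet_val (sheet_act x p) = x * sheet_val p.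
Proof.
have gen y q : sheet_val (sheet_fun y q) = free_gen y * sheet_val q.
  case: q => -[v|] w; rewrite /sheet_val /=; last first.
    by case: y => y; rewrite /= ?gmulfM ?starE !mul1g.
  rewrite gmulfM starE /=; case: ifP => [/eqP ->|_].
    by rewrite mul1g !mulgA.
  by rewrite !mulgA mulgV mul1g.
elim/free_group_ind: x p => [|y x IHx|y x IHx] p.
- by rewrite hom1 mul1g.
- by rewrite gmulfM bijM sheet_act_gen gen IHx mulgA.
- rewrite gmulfM bijM sheet_act_genV -mulgA -IHx.
  by rewrite -{2}[sheet_act x p](sheet_invK y) gen mulKg.
Qed.

Lemma fi_range_star : fi_subgroup (range star).
Proof.
have sR : is_subgroup (range star).
  split; first by exists 1; rewrite ?hom1.
    by move=> _ _ [x _ <-] [y _ <-]; exists (x * y); rewrite ?gmulfM.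
  by move=> _ [x _ <-]; exists x^-1; rewrite ?homV.
split=> //; apply/(finite_indexP sR).
pose rep (v : option X0) : free_group X :=
  if v is Some y then free_gen (inl y) else 1.
exists [seq rep v | v : option X0] => x.
have := sheet_val_act x (None, 1); rewrite {2}/sheet_val /= hom1 !mulg1.
case: (sheet_act x _) => v w <-; exists (rep v); first exact: codom_f.
by exists w => //; rewrite mulKg.
Qed.

End StarCover.

(** * Free actions of a finite subgroup *)

Section BijectionSumProd.
Variables X Y : Type.

Definition bij_sum (s : bijection X) (t : bijection Y) : bijection (X + Y).
Proof.
pose map (f : X -> X) (g : Y -> Y) (z : X + Y) :=
  match z with inl x => inl (f x) | inr y => inr (g y) end.
apply: (@Bijection _ (map s t) (map (bij_inv s) (bij_inv t))) => -[x|y] /=;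
  by rewrite ?bij_funK ?bij_invK.
Defined.

Definition bij_prod (s : bijection X) (t : bijection Y) : bijection (X * Y).
Proof.
pose map (f : X -> X) (g : Y -> Y) (z : X * Y) := (f z.1, g z.2).
apply: (@Bijection _ (map s t) (map (bij_inv s) (bij_inv t))) => -[x y];
  by rewrite /map /= ?bij_funK ?bij_invK.
Defined.

Variables (U : groupType) (D : set U).
Variables (a : U -> bijection X) (b : U -> bijection Y).

Lemma acts_freely_sum : acts_freely D a -> acts_freely D b ->
  acts_freely D (fun g => bij_sum (a g) (b g)).
Proof.
move=> [aM aF] [bM bF]; split=> [g h Dg Dh|g [x|y] Dg /= []].
- by apply: bijection_ext => -[x|y] /=; rewrite ?aM ?bM.
- exact: aF.
- exact: bF.
Qed.

Lemma acts_freely_prod : acts_freely D a -> acts D b ->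
  acts_freely D (fun g => bij_prod (a g) (b g)).
Proof.
move=> [aM aF] bM; split=> [g h Dg Dh|g [x y] Dg [ax _]].
- by apply: bijection_ext => -[x y]; rewrite /= aM ?bM.
- exact: aF ax.
Qed.

End BijectionSumProd.

(** The action permutes the vertices and edges of the cover, fixing the base vertex [None] and
    preserving the star tree; hence it permutes the non-tree edges, which form the basis. *)
Lemma comm_equiv_star (U : groupType) (D : set U) (X0 X1 : finType)
    (a0 : U -> bijection X0) (a1 : U -> bijection X1) :
  comm_equiv D
    (fun g => bij_sum (a1 g) (bij_prod (a0 g) (bij_sum (a0 g) (a1 g))))
    (fun g => bij_sum (a0 g) (a1 g)).
Proof.
apply: (comm_equiv_embedding (@star_inj X0 X1) (@fi_range_star X0 X1)).
move=> g z Dg; rewrite !starE.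
case: z => [x|[y x]]; first by rewrite /= free_map_gen.
(* By injectivity, the case distinction in [star_gen] is invariant under the action. *)
have xyE : (bij_sum (a0 g) (a1 g) x == inl (a0 g y)) = (x == inl y).
  exact: (inj_eq (@bij_fun_inj _ (bij_sum (a0 g) (a1 g))) x (inl y)).
rewrite -[LHS]/(star_gen (inr (a0 g y, bij_sum (a0 g) (a1 g) x))) /star_gen xyE.
by case: ifP => _; rewrite !gmulfM ?homV !free_map_gen.
Qed.

Section FiniteSubgroup.
Variables (U : groupType) (D : set U) (elts : seq U).
Hypotheses (sD : is_subgroup D) (DE : D = [set` elts]).

Local Notation S := (seq_sub elts).

Let eltsP (g : U) : reflect (D g) (g \in elts).
Proof. by rewrite DE; apply: idP. Qed.

Let lmul_fun (g : U) (x : S) : S := insubd x (g * val x).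

Let val_lmul_fun g x : D g -> val (lmul_fun g x) = g * val x.
Proof.
have [_ DM _] := sD => Dg; apply: insubdK; apply/eltsP/DM => //.
exact/eltsP/valP.
Qed.

Let lmul_funK g : D g -> cancel (lmul_fun g) (lmul_fun g^-1).
Proof.
have [_ _ DV] := sD; move=> Dg x; apply: val_inj.
by rewrite !val_lmul_fun ?mulKg //; apply: DV.
Qed.

(** The left regular action of [D], set to the identity outside [D]. The [eq_ind] term rewrites
    [g^-1^-1] to [g] in the second cancellation law. *)
Definition lmul (g : U) : bijection S :=
  if pselect (D g) is left Dg then
    Bijection (lmul_funK Dg)
      (fun x => eq_ind _ (fun h => lmul_fun h (lmul_fun g^-1 x) = x)
        (lmul_funK (let: And3 _ _ DV := sD in DV _ Dg) x) _ (invgK g))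
  else 1.

Lemma val_lmul g x : D g -> val (lmul g x) = g * val x.
Proof.
by rewrite /lmul => Dg; case: pselect => // Dg'; apply: val_lmul_fun.
Qed.

Lemma lmul_freely : acts_freely D lmul.
Proof.
have [_ DM _] := sD; split=> [g h Dg Dh|g x Dg /(congr1 val)].
  apply: bijection_ext => x; apply: val_inj; rewrite bijM !val_lmul ?mulgA //.
  exact: DM.
by rewrite val_lmul // => /(canRL (mulgK _)); rewrite mulgV.
Qed.

Definition lmul_copies r (g : U) : bijection (S * 'I_r) := bij_prod (lmul g) 1.

Lemma lmul_copies_freely r : acts_freely D (lmul_copies r).
Proof.
apply: (acts_freely_prod lmul_freely) => g h _ _.
by apply: bijection_ext => i.
Qed.

(** [r] is the number of orbits: a point in each orbit identifies it with the regular action. *)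
Lemma free_action_classification (X : finType) (a : U -> bijection X) :
  acts_freely D a -> exists r (e : S * 'I_r -> X),
    bijective e /\ forall g z, D g -> e (lmul_copies r g z) = a g (e z).
Proof.
have [D1 DM DV] := sD; move=> [aM aF].
have a1 : a 1 = 1 by apply: (mulgI (a 1)); rewrite -aM // !mulg1.
have aV g : D g -> a g^-1 = (a g)^-1.
  by move=> Dg; apply: (mulgI (a g)); rewrite -aM ?mulgV ?a1 //; apply: DV.
have DS (g : S) : D (val g) by apply/eltsP/valP.
pose rel x y := [exists g : S, a (val g) x == y].
have relP x y : reflect (exists2 g, D g & a g x = y) (rel x y).
  apply: (iffP existsP) => [[g /eqP <-]|[g Dg <-]]; first by exists (val g).
  by move/eltsP: Dg => gs; exists (SeqSub gs).
have relE g x : D g -> rel (a g x) =1 rel x.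
  move=> Dg y; apply/relP/relP => -[h Dh <-].
    by exists (h * g); [exact: DM|rewrite aM].
  exists (h * g^-1); first by apply: DM => //; apply: DV.
  by rewrite aM ?aV; [rewrite bijM -[X in a h X]bijM mulVg|..|exact: DV].
have rel_refl x : rel x x by apply/relP; exists 1; rewrite ?a1.
(* [pick] depends only on the predicate [rel x], which is the same along an orbit, so [rep] is
   constant on orbits; the default is never reached. *)
pose rep x := odflt x [pick y | rel x y].
have rel_rep x : rel x (rep x).
  by rewrite /rep; case: pickP => // /(_ x); rewrite rel_refl.
have repE g x : D g -> rep (a g x) = rep x.
  move=> Dg; rewrite /rep (eq_pick (relE _ _ Dg)).
  by case: pickP => // /(_ x); rewrite rel_refl.
pose A := [pred x | rep x == x].
have repA (i : 'I_#|A|) : rep (enum_val i) = enum_val i.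
  by have /eqP := enum_valP i.
exists #|A|, (fun z => a (val z.1) (enum_val z.2)); split; last first.
  by move=> g [x i] Dg /=; rewrite val_lmul // aM.
have inj : injective (fun z : S * 'I_#|A| => a (val z.1) (enum_val z.2)).
  move=> [g i] [h j] /= ghE.
  have ij : i = j.
    apply: enum_val_inj; rewrite -(repA i) -(repA j).
    by rewrite -(repE _ _ (DS g)) ghE (repE _ _ (DS h)).
  rewrite -{j}ij in ghE *; congr (_, _); apply: val_inj.
  apply: (mulgI (val h)^-1); rewrite mulVg; apply: (aF _ (enum_val i)).
    by apply: DM => //; apply: DV.
  rewrite aM ?aV // ?bijM ?ghE; last exact: DV.
  by rewrite -bijM mulVg.
apply: inj_card_bij => //; rewrite -(card_codom inj).
apply: subset_leq_card; apply/fintype.subsetP => x _; apply/codomP.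
have /relP[g Dg gx] := rel_rep x.
have /eltsP gs : D g^-1 by apply: DV.
have Arep : rep x \in A by rewrite inE -{1}gx repE.
exists (SeqSub gs, enum_rank_in Arep (rep x)) => /=.
by rewrite enum_rankK_in // aV // -gx -bijM mulVg.
Qed.

(** * Comparing ranks of free actions *)

Local Notation h := #|{: S}|.

Lemma card_freely (X : finType) (a : U -> bijection X) :
  acts_freely D a -> exists r, #|X| = (h * r)%N.
Proof.
move=> /free_action_classification[r [e [e_bij _]]]; exists r.
by rewrite -(bij_eq_card e_bij) card_prod card_ord.
Qed.

Lemma card_elts_gt0 : 0 < h.
Proof.
have [/eltsP s1 _ _] := sD; apply/card_gt0P.
by exists (SeqSub s1).
Qed.

Lemma comm_equiv_card (X Y : finType) (a : U -> bijection X)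
    (b : U -> bijection Y) :
  acts_freely D a -> acts_freely D b -> #|X| = #|Y| -> comm_equiv D a b.
Proof.
move=> /free_action_classification[r [e [e_bij eP]]].
move=> /free_action_classification[q [e' [e'_bij e'P]]].
rewrite -(bij_eq_card e_bij) -(bij_eq_card e'_bij) !card_prod !card_ord.
move=> /eqP; rewrite eqn_pmul2l ?card_elts_gt0 // => /eqP rq; subst q.
apply: (@comm_equiv_trans _ _ _ _ _ _ (lmul_copies r)).
  exact/comm_equiv_sym/(comm_equiv_bij e_bij).
exact: (comm_equiv_bij e'_bij).
Qed.

(** The star cover with [m] orbits in [X0] and [k] in [X1]; free actions with equally many points
    are isomorphic, so only cardinals need to match. *)
Lemma comm_equiv_cover m k :
  comm_equiv D (lmul_copies (m + k)) (lmul_copies (k + m * (h * (m + k)))).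
Proof.
have free0 := lmul_copies_freely m; have free1 := lmul_copies_freely k.
have freeX := acts_freely_sum free0 free1.
have freeZ := acts_freely_sum free1 (acts_freely_prod free0 freeX.1).
apply/comm_equiv_sym/(comm_equiv_trans _ (comm_equiv_trans
  (@comm_equiv_star U D _ _ (lmul_copies m) (lmul_copies k)) _)).
- apply: comm_equiv_card (lmul_copies_freely _) freeZ _.
  by rewrite !(card_sum, card_prod, card_ord) -!mulnDr -mulnA -mulnDr.
- apply: comm_equiv_card freeX (lmul_copies_freely _) _.
  by rewrite !(card_sum, card_prod, card_ord) mulnDr.
Qed.

(** The equation says [h * q - 1 = (h * r - 1) * (1 + h * m)] without subtraction: Euler
    characteristic is multiplied by the degree of the cover. *)
Lemma comm_equiv_scale r m q : m <= r ->
  (h * q + h * m)%N = (h * r + h * m * (h * r))%N ->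
  comm_equiv D (lmul_copies r) (lmul_copies q).
Proof.
move=> mr hq; have := comm_equiv_cover m (r - m); rewrite subnKC //.
suff -> : q = (r - m + m * (h * r))%N by [].
apply/eqP; rewrite -(eqn_pmul2l card_elts_gt0); apply/eqP.
move: (r - m)%N (subnKC mr) hq => k <-; move: #|_| => n; lia.
Qed.

(** Iterates the cover with [m = 1], of degree [1 + h], available as long as one orbit is
    present. *)
Lemma comm_equiv_grow r N : 0 < r -> exists2 q,
  comm_equiv D (lmul_copies r) (lmul_copies q) &
  (h * q).-1 = ((h * r).-1 * (1 + h) ^ N)%N /\ 0 < q.
Proof.
move=> r0; elim: N => [|N [q rq [qE q0]]].
  exists r; last by rewrite expn0 muln1.
  exact: (comm_equiv_card (lmul_copies_freely r) (lmul_copies_freely r)).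
have h0 := card_elts_gt0.
have qq' : comm_equiv D (lmul_copies q) (lmul_copies (q.-1 + h * q)).
  apply: (@comm_equiv_scale _ 1) => //.
  by case: q q0 {rq qE} => // q _; move: #|_| => n; nia.
exists (q.-1 + h * q)%N; first exact: comm_equiv_trans rq qq'.
rewrite expnSr mulnA -qE; split; last by rewrite addn_gt0 muln_gt0 h0 q0 orbT.
case: q q0 {rq qE qq'} => // q _; move: #|_| h0 => n; nia.
Qed.

(** Both factors are [-1] modulo [n]. The hypotheses ensure that the subtractions in the witness are
    not truncated. *)
Lemma predn_mul_mod n r s : 1 < n * r -> 1 < n * s ->
  exists m, ((n * r).-1 * (n * s).-1)%N = (1 + n * m)%N.
Proof.
move=> nr ns; exists (n * r * s - r - s)%N.
have n0 : 0 < n by case: n nr {ns}.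
have le : r + s <= n * r * s.
  rewrite -(leq_pmul2l n0).
  have -> : (n * (n * r * s) = (n * r) * (n * s))%N by ring.
  rewrite mulnDr; case: (n * r)%N (n * s)%N nr ns => // x [] // y; nia.
have : (n * r * s - r - s + (r + s) = n * r * s)%N by lia.
move: (_ - s)%N => m mE.
have : (n * m + (n * r + n * s) = (n * r) * (n * s))%N.
  by rewrite -!mulnDr mE; ring.
by case: (n * r)%N (n * s)%N nr ns => // x [] // y _ _ /=; lia.
Qed.

(* Write [f r = h * r - 1], so that [comm_equiv_scale] multiplies [f r] by    *)
(* any [1 + h * m] with [m <= r]. Multiplying by powers of [1 + h] makes room *)
(* for large factors; since [f r] and [f s] are [-1] modulo [h], the factors  *)
(* [f r * f s] and [f r * f r] are allowed, and they bring [f r] and [f s] to *)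
(* a common value.                                                            *)
Lemma comm_equiv_copies r s : 1 < h * r -> 1 < h * s ->
  comm_equiv D (lmul_copies r) (lmul_copies s).
Proof.
have h0 := card_elts_gt0 => hr hs.
have r0 : 0 < r by case: r hr => //; rewrite muln0.
have s0 : 0 < s by case: s hs => //; rewrite muln0.
(* [N] bounds both [h * m = A * B - 1] and [h * m' = A * A - 1], so [N < (1 + h) ^ N] yields
   [m <= r'] and [m' <= s']. The common value is [A * A * B * (1 + h) ^ N]. *)
pose A := (h * r).-1; pose B := (h * s).-1; pose N := (A * B + A * A)%N.
have [r' rr' [r'E r'0]] := comm_equiv_grow N r0.
have [s' ss' [s'E s'0]] := comm_equiv_grow N s0.
have NE : N < (1 + h) ^ N by apply: ltn_expl.
have [m mE] := predn_mul_mod hr hs; have [m' m'E] := predn_mul_mod hr hr.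
have A0 : 0 < A by rewrite /A; lia.
have B0 : 0 < B by rewrite /B; lia.
rewrite -/A -/B in mE m'E r'E s'E.
have hr'E : (h * r' = 1 + A * (1 + h) ^ N)%N.
  by rewrite -r'E add1n prednK // muln_gt0 h0.
have hs'E : (h * s' = 1 + B * (1 + h) ^ N)%N.
  by rewrite -s'E add1n prednK // muln_gt0 h0.
have mr' : m <= r'.
  have hmN : h * m <= (1 + h) ^ N.
    by apply: leq_trans (ltnW NE); rewrite /N mE; lia.
  rewrite -(leq_pmul2l h0) hr'E; apply: leq_trans hmN (leqW (leq_pmull _ A0)).
have ms' : m' <= s'.
  have hmN : h * m' <= (1 + h) ^ N.
    by apply: leq_trans (ltnW NE); rewrite /N m'E; lia.
  rewrite -(leq_pmul2l h0) hs'E; apply: leq_trans hmN (leqW (leq_pmull _ B0)).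
pose q := (r' - m + m * (h * r'))%N.
have hq : (h * q + h * m = h * r' + h * m * (h * r'))%N.
  by rewrite /q mulnDr addnAC -mulnDr subnK // mulnA.
apply: comm_equiv_trans rr' (comm_equiv_trans (comm_equiv_scale mr' hq) _).
apply: comm_equiv_sym (comm_equiv_trans ss' (comm_equiv_scale ms' _)).
apply/eqP; rewrite -(eqn_add2r (h * m)); apply/eqP; rewrite addnAC hq hr'E hs'E.
have : (A * (1 + h) ^ N * (1 + h * m) = B * (1 + h) ^ N * (1 + h * m'))%N.
  by rewrite -mE -m'E; ring.
move: (_ ^ N)%N (h * m)%N (h * m')%N => P x y; clear; lia.
Qed.

(** Two points make [h * r - 1] positive; a value of zero would stay zero under every cover. *)
Lemma comm_equiv_free (X Y : finType) (a : U -> bijection X)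
    (b : U -> bijection Y) : acts_freely D a -> acts_freely D b ->
  1 < #|X| -> 1 < #|Y| -> comm_equiv D a b.
Proof.
move=> free_a free_b.
have [r Xr] := card_freely free_a; have [s Ys] := card_freely free_b.
rewrite Xr Ys => hr hs.
apply: comm_equiv_trans (comm_equiv_trans _ (comm_equiv_copies hr hs)) _.
  apply: comm_equiv_card free_a (lmul_copies_freely r) _.
  by rewrite card_prod card_ord Xr.
apply: comm_equiv_card (lmul_copies_freely s) free_b _.
by rewrite card_prod card_ord Ys.
Qed.

End FiniteSubgroup.

(** * Exhausting a locally finite group *)

Lemma hom_inj (G H : groupType) (f : {multiplicative G -> H}) :
  (forall x, f x = 1 -> x = 1) -> injective f.
Proof.
move=> f1 x y fxy; apply: (mulIg y^-1); rewrite mulgV; apply: f1.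
by rewrite gmulfM homV fxy mulgV.
Qed.

Lemma acts_freely_sub (U : groupType) (D E : set U) (X : Type)
    (a : U -> bijection X) :
  D `<=` E -> acts_freely E a -> acts_freely D a.
Proof.
move=> DE [aM aF]; split=> [g h /DE Eg /DE Eh|g x /DE]; first exact: aM.
exact: aF.
Qed.

Lemma subgroup_generatedP (G : groupType) (A : set G) :
  is_subgroup (subgroup_generated A).
Proof.
split=> [|x y Ax Ay|x Ax] H HP; have [[H1 HM HV] _] := HP.
- exact: H1.
- by apply: HM; [exact: (Ax H)|exact: (Ay H)].
- by apply: HV; exact: (Ax H).
Qed.

(** * Extending embeddings of finite subgroups *)

Section FreelyRealized.
Variables (U C : groupType).

(** The invariant of the induction: the set [X] changes with [D], and [theta] carries its
    commensurator into the fixed target [C]. *)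
Definition freely_realized (D : set U) (phi : U -> C) : Prop :=
  exists (X : finType) (a : U -> bijection X)
      (theta : {multiplicative Comm (free_group X) -> C}),
    [/\ acts_freely D a, 1 < #|X|, injective theta
      & forall g, D g -> phi g = theta (perm_class (a g))].

Variables (D : set U) (sD : is_subgroup D) (phi : U -> C).
Hypothesis phiP : freely_realized D phi.

Lemma freely_realizedM g h : D g -> D h -> phi (g * h) = phi g * phi h.
Proof.
have [X [a [theta [[aM _] _ _ phiE]]]] := phiP; have [_ DM _] := sD => Dg Dh.
by rewrite !phiE ?aM ?gmulfM //; apply: DM.
Qed.

Lemma freely_realized_eq1 g : D g -> phi g = 1 -> g = 1.
Proof.
have [X [a [theta [[_ aF] X1 theta_inj phiE]]]] := phiP => Dg.
rewrite phiE // -(hom1 theta) => /theta_inj/perm_class_eq1 ag1.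
have [x _] := card_gt0P (ltnW X1).
by apply: (aF g x) => //; rewrite ag1.
Qed.

(** A free action of [E] is free on [D], hence equivalent there to the given one; composing with
    this equivalence [tau] makes the new map agree with [phi] on [D]. *)
Lemma freely_realized_extend (E : set U) :
  is_subgroup E -> finite_set E -> D `<=` E ->
  exists2 psi, freely_realized E psi & forall g, D g -> psi g = phi g.
Proof.
move=> sE /[dup] fE /finite_seqP[e eE] DE.
have /finite_seqP[d dE] : finite_set D by apply: sub_finite_set fE.
have [X [a [theta [free_a X1 theta_inj phiE]]]] := phiP.
(* Two copies give at least two points even when [E] is trivial. *)
have free_b := lmul_copies_freely sE eE 2.
have Y1 : 1 < #|{: seq_sub e * 'I_2}|.
  by rewrite card_prod card_ord; have := card_elts_gt0 sE eE; move: #|_|; lia.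
have [tau [/bij_inj tau_inj tauP]] :=
  comm_equiv_free sD dE (acts_freely_sub DE free_b) free_a Y1 X1.
exists (fun g => theta (tau (perm_class (lmul_copies sE eE 2 g)))).
  exists _, (lmul_copies sE eE 2), (theta \o tau).
  by split=> //; apply: inj_comp.
by move=> g Dg; rewrite tauP // phiE.
Qed.

End FreelyRealized.

Lemma locally_finite_embedding (U C : groupType) (phi0 : U -> C) :
  countable [set: U] -> locally_finite U ->
  freely_realized (subgroup_generated set0) phi0 ->
  exists f : {multiplicative U -> C}, injective f.
Proof.
move=> /countable_injP[code code_inj] U_lf phi0P.
pose A n := [set g : U | code g < n].
pose D n := subgroup_generated (A n).
have fD n : finite_set (D n).
  apply: U_lf.
  apply: (@finite_preimage _ _ `I_n code _ (finite_II n)) => x y _ _.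
  by apply: code_inj; rewrite inE.
have sD n : is_subgroup (D n) by apply: subgroup_generatedP.
have D_mono m n : m <= n -> D m `<=` D n.
  move=> mn g Dg H [sH AH]; apply: (Dg H); split=> // x /= xm; apply: AH.
  exact: leq_trans xm mn.
have D0 : D 0%N = subgroup_generated set0.
  by congr subgroup_generated; apply/seteqP; split.
rewrite -D0 in phi0P.
(* Each stage carries its realization, since the extension lemma needs it and guarantees agreement
   only with the preceding stage. *)
pose next n (p : {phi : U -> C | freely_realized (D n) phi}) :=
  cid2 (freely_realized_extend (sD n) (svalP p) (sD n.+1) (fD n.+1)
    (D_mono _ _ (leqnSn n))).
pose st := fix st n : {phi | freely_realized (D n) phi} :=
  if n is n'.+1
  then exist _ (s2val (next n' (st n'))) (s2valP (next n' (st n')))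
  else exist _ phi0 phi0P.
pose phi n := sval (st n).
have phiP n : freely_realized (D n) (phi n) := svalP (st n).
have phi_agree m n g : m <= n -> D m g -> phi n g = phi m g.
  move=> + Dg; elim: n => [|n IHn]; first by rewrite leqn0 => /eqP ->.
  rewrite leq_eqVlt => /predU1P[-> //|]; rewrite ltnS => mn.
  rewrite -(IHn mn); apply: (s2valP' (next n (st n))).
  exact: (D_mono m n mn g Dg).
have D_code g : D (code g).+1 g by move=> H [_ AH]; apply: AH; apply: ltnSn.
(* Stage [(code g).+1] is the first whose generating set contains [g]; all later stages agree with
   it at [g]. *)
pose f g := phi (code g).+1 g.
have fE n g : code g < n -> f g = phi n g.
  by move=> gn; rewrite (phi_agree _ _ _ gn).
have D_lt n g : code g < n -> D n g.
  by move=> gn; exact: (D_mono _ _ gn g (D_code g)).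
have fM : {morph f : g h / g * h}.
  move=> g h; pose n := (code g + code h + code (g * h)).+1.
  have gn : code g < n by rewrite /n; lia.
  have hn : code h < n by rewrite /n; lia.
  rewrite (fE n) ?(fE n g) ?(fE n h) //; last by rewrite /n; lia.
  exact: (freely_realizedM (sD n) (phiP n) (D_lt _ _ gn) (D_lt _ _ hn)).
pose f_hom := HB.pack_for {multiplicative U -> C}
  f (isMultiplicative.Build _ _ f fM).
exists f_hom; apply: hom_inj => g fg1.
exact: (freely_realized_eq1 (phiP _) (D_code g) fg1).
Qed.

Theorem mainTheorem1 (U : groupType) (k : nat) :
  hall_universal U -> 2 <= k ->
  exists f : {multiplicative U -> Comm (free_group 'I_k)}, injective f.
Proof.
move=> [U_countable U_lf _ _] k2.
apply: (@locally_finite_embedding _ _ (fun _ => perm_class 1)) => //.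
(* Base case: the trivial subgroup acts freely on ['I_k], which has two points since [2 <= k]; this
   fixes the target commensurator. *)
exists 'I_k, (fun _ => 1), idfun; split=> //; last by rewrite card_ord.
split=> [g h _ _|g x gen1 _]; first by rewrite mulg1.
apply: (gen1 [set 1]); split=> //.
by split=> [//|y z -> ->|y ->]; rewrite ?mulg1 ?invg1.
Qed.
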